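(* Let $\Delta\geq 4$ be an integer, let $G=(V,E)$ be a finite simple undirected graph of maximum degree at most $\Delta$, let $M^*$ be a maximum matching of $G$, and let $M$ be the matching output by any run of the \textsc{1-2-MinGreedy} algorithm on $G$. Then $|M|\geq \frac{\Delta-1}{2\Delta-3}|M^*|$.
   Context: The (deterministic) \textsc{1-2-MinGreedy} algorithm starts with $M=\emptyset$ and repeats until no edges remain in the current graph (initially $G$): if every node has current degree at least $3$, it selects an arbitrary edge $\{u,v\}$; otherwise it selects an arbitrary node $u$ of minimum non-zero current degree and an arbitrary neighbor $v$ of $u$. It then adds $\{u,v\}$ to $M$ and removes all edges incident with $u$ or $v$ from the current graph. All arbitrary choices may be made adversarially; the claim holds for every run. *)

(* Defs.v *)
From mathcomp Require Import all_boot.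
Set Implicit Arguments. Unset Strict Implicit. Unset Printing Implicit Defensive.

Definition simple_graph (T : finType) (e : rel T) : Prop :=
  symmetric e /\ irreflexive e.

Definition deg (T : finType) (e : rel T) (x : T) : nat := #|[set y | e x y]|.

Definition max_deg_le (T : finType) (e : rel T) (D : nat) : Prop :=
  forall x, deg e x <= D.

Definition is_matching (T : finType) (e : rel T) (M : {set {set T}}) : Prop :=
  (forall A, A \in M -> exists x y, e x y /\ A = [set x; y]) /\
  (forall A B, A \in M -> B \in M -> A != B -> [disjoint A & B]).

Definition is_maximum_matching (T : finType) (e : rel T) (M : {set {set T}}) : Prop :=
  is_matching e M /\ forall N, is_matching e N -> #|N| <= #|M|.

Definition cur (T : finType) (e : rel T) (S : {set T}) : rel T :=
  fun x y => [&& e x y, x \notin S & y \notin S].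

Definition cdeg (T : finType) (e : rel T) (S : {set T}) (x : T) : nat :=
  #|[set y | cur e S x y]|.

(* [mingreedy_run e S s] : the sequence s of selected pairs (u,v) is a
   complete run of 1-2-MinGreedy started from the current graph obtained
   from G by deleting edges incident with S.  At each step, either every
   non-isolated node has current degree >= 3 and an arbitrary current edge
   {u,v} is chosen, or u is a node of minimum non-zero current degree and v
   is a current neighbour of u.  The run stops exactly when no edges remain. *)
Fixpoint mingreedy_run (T : finType) (e : rel T) (S : {set T})
    (s : seq (T * T)) : Prop :=
  match s with
  | [::] => forall x y, ~~ cur e S x y
  | (u, v) :: s' =>
      [/\ cur e S u v,
          (forall x, 0 < cdeg e S x -> 3 <= cdeg e S x) \/
          (forall x, 0 < cdeg e S x -> cdeg e S u <= cdeg e S x)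
        & mingreedy_run e (u |: (v |: S)) s']
  end.

Definition run_matching (T : finType) (s : seq (T * T)) : {set {set T}} :=
  [set [set p.1; p.2] | p in [seq q | q <- s]].

(* Main.v *)
(** Amortise over the run.  Call a live node free if its M*-edge is dead, and
charge D-1 for every M*-edge that dies and credit 2D-3 for every step.  A step
killing at most one M*-edge leaves at least D-2.  A step {u,v} killing two
M*-edges has deficit 1; it happens only when no node has degree 1, and then one
of the two nodes freed by it, chosen with the larger remaining degree, becomes
indebted for 1.  An indebted node is never isolated for free: the step that
reduces its degree to at most 1 pays 1/2, and the step that isolates it pays
the other 1/2.  A step that cannot pay for the nodes it reduces to degree 1
passes the sum on as a token.  As long as degree-1 nodes exist every step
selects one, so it kills at most one M*-edge and, after paying for the at most
D-1 indebted neighbours of its other endpoint, saves at least (D-3)/2, which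
lets the token be cleared before the degree-1 nodes run out. *)

Require Import Defs.
From mathcomp Require Import all_boot zify.
Set Implicit Arguments. Unset Strict Implicit. Unset Printing Implicit Defensive.

(** * Edges selected along a run *)

Lemma run_matching_cons (T : finType) (p : T * T) s :
  run_matching (p :: s) = [set p.1; p.2] |: run_matching s.
Proof.
apply/setP => A; rewrite /run_matching !map_id in_setU1.
apply/imsetP/predU1P => [[q]|[->|/imsetP[q qs ->]]].
- by rewrite inE => /predU1P[->|qs] ->; [left|right; apply/imsetP; exists q].
- by exists p; rewrite // inE eqxx.
- by exists q; rewrite // inE qs orbT.
Qed.

Lemma run_matching_disjoint (T : finType) (e : rel T) s S A :
  mingreedy_run e S s -> A \in run_matching s -> [disjoint A & S].
Proof.
elim: s S => [|[u v] s IH] S /=; first by move=> _ /imsetP[].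
case=> /and3P[_ uS vS] _ /IH dis; rewrite run_matching_cons in_setU1.
case/predU1P => [->|/dis dA]; rewrite disjoints_subset.
  by apply/subsetP => x; rewrite !inE => /orP[] /eqP->.
rewrite -disjoints_subset; apply: disjointWr dA.
by apply/subsetP => x xS; rewrite !inE xS !orbT.
Qed.

(** [run_matching] is a set, so equal pairs would merge; none do, because later pairs avoid all
    nodes already deleted. *)
Lemma size_run_matching (T : finType) (e : rel T) s S :
  mingreedy_run e S s -> size s <= #|run_matching s|.
Proof.
elim: s S => [|[u v] s IH] S //= [_ _ run].
rewrite run_matching_cons cardsU1 /=.
have -> : [set u; v] \notin run_matching s.
  apply/negP => /(run_matching_disjoint run) dA.
  by have := disjointFr dA (set21 u v); rewrite !inE eqxx.
by rewrite add1n ltnS (IH _ run).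
Qed.

(** * The partner involution of a matching *)

Section Partner.
Variables (T : finType) (e : rel T) (M : {set {set T}}).
Hypothesis e_sym : symmetric e.
Hypothesis e_irr : irreflexive e.
Hypothesis M_matching : is_matching e M.

Definition partner (x : T) : T :=
  if [pick y | ([set x; y] \in M) && (y != x)] is Some y then y else x.

Lemma partnerE x y : [set x; y] \in M -> y != x -> partner x = y.
Proof.
move=> xyM yx; rewrite /partner; case: pickP => [z|/(_ y)]; last by rewrite xyM yx.
case/andP => xzM _; apply/esym/eqP; move: (set22 x y).
have -> : [set x; y] = [set x; z].
  apply/eqP/contraT => /(M_matching.2 _ _ xyM xzM) dis.
  by have := disjointFr dis (set21 x y); rewrite set21.
by rewrite !inE (negPf yx).
Qed.

Lemma partner_in x : partner x != x -> [set x; partner x] \in M.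
Proof. by rewrite /partner; case: pickP => [y /andP[]|]; rewrite ?eqxx. Qed.

Lemma partnerK : involutive partner.
Proof.
move=> x; case: (eqVneq (partner x) x) => [E|xx]; first by rewrite !E.
by apply: partnerE; rewrite 1?eq_sym // setUC partner_in.
Qed.

Lemma partner_edge x : partner x != x -> e x (partner x).
Proof.
move=> xx; have [a [b [ab E]]] := M_matching.1 _ (partner_in xx).
move: (set21 x (partner x)) (set22 x (partner x)) xx; rewrite E !inE.
by do 2![case/orP => /eqP ->]; rewrite ?eqxx // e_sym.
Qed.

Lemma card_partner : #|[set x | partner x != x]| = 2 * #|M|.
Proof.
have edge A : A \in M -> exists x y, [/\ A = [set x; y], x != y & A \in M].
  move=> AM; have [x [y [xy E]]] := M_matching.1 _ AM.
  by exists x, y; split=> //; apply: contraTneq xy => ->; rewrite e_irr.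
have -> : [set x | partner x != x] = cover M.
  apply/setP => x; rewrite inE; apply/idP/bigcupP => [xx|[A /edge[a [b [-> ab abM]]]]].
    by exists [set x; partner x]; [exact: partner_in|exact: set21].
  rewrite !inE => /orP[] /eqP ->.
    by rewrite (partnerE abM) eq_sym.
  by rewrite setUC in abM; rewrite (partnerE abM).
rewrite mulnC; apply: card_uniform_partition => [A /edge[x [y [-> xy _]]]|].
  by rewrite cards2 xy.
apply/and3P; split=> //; first by apply/trivIsetP; exact: M_matching.2.
by apply/negP => /edge[x [y [E _ _]]]; have := set21 x y; rewrite -E inE.
Qed.

End Partner.

(* lia would case-split on every boolean membership hypothesis. *)
Ltac nlia :=
  repeat match goal with
  | H : is_true ?b |- _ =>
      lazymatch b with
      | leq _ _ => fail
      | andb _ _ => fail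
      | _ => clear H
      end
  | H : forall _, _ |- _ => clear H
  end; lia.

(* D = d + 4 is the degree bound and m the M*-partner, with m x = x when x is
   not covered by M*. *)
Section Potential.
Variables (d : nat) (T : finType) (e : rel T) (m : T -> T).
Hypothesis e_sym : symmetric e.
Hypothesis e_irr : irreflexive e.
Hypothesis e_deg : max_deg_le e d.+4.
Hypothesis mK : involutive m.
Hypothesis e_m : forall x, m x != x -> e x (m x).

Implicit Types (S A B X : {set T}) (u v w x y z : T).

Definition nb S x : {set T} := [set y | cur e S x y].
(* The endpoints of the edges {x, m x} of M* that are still alive. *)
Definition cov S : {set T} := [set x | [&& m x != x, x \notin S & m x \notin S]].
Definition ones S : {set T} := [set x | cdeg e S x == 1].
(* B is the set of indebted nodes; all amounts are doubled to stay integral. *)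
Definition phi S B : nat := \sum_(w in B) minn 2 (cdeg e S w).

(** * Degrees and live M*-edges under one step *)

Lemma cur_sym S : symmetric (cur e S).
Proof. by move=> x y; rewrite /cur e_sym [(x \notin S) && _]andbC. Qed.

Lemma cdeg_le S x : cdeg e S x <= d.+4.
Proof.
apply: leq_trans (e_deg x); apply: subset_leq_card.
by apply/subsetP => y; rewrite !inE => /andP[].
Qed.

Lemma cur_cdeg S x y : cur e S x y -> 0 < cdeg e S x.
Proof. by move=> xy; apply/card_gt0P; exists y; rewrite inE. Qed.

Lemma cur_neq S x y : cur e S x y -> x != y.
Proof. by case/and3P => exy _ _; apply: contraTneq exy => ->; rewrite e_irr. Qed.

Lemma cov_m S x : x \in cov S -> m x \in cov S.
Proof. by rewrite !inE mK eq_sym => /and3P[-> -> ->]. Qed.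

Lemma cov_cur S x : x \in cov S -> cur e S x (m x).
Proof. by rewrite inE /cur => /and3P[/e_m -> -> ->]. Qed.

Lemma cdeg_step S u v w : cur e S u v -> w != u -> w != v ->
  cdeg e S w = cdeg e (u |: (v |: S)) w + cur e S w u + cur e S w v.
Proof.
move=> uv wu wv; rewrite /cdeg (cardsD1 u) (cardsD1 v (_ :\ u)) !inE.
rewrite eq_sym (cur_neq uv) /=.
suff -> : [set y | cur e S w y] :\ u :\ v = [set y | cur e (u |: (v |: S)) w y]
  by nlia.
apply/setP => y; rewrite !inE /cur !inE !negb_or (negPf wu) (negPf wv) /=.
by do ![case: (_ == _) => //=]; rewrite ?andbF.
Qed.

Lemma cov_step_sub S u v : cov (u |: (v |: S)) \subset cov S.
Proof.
apply/subsetP => x; rewrite !inE !negb_or.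
by case/and3P => -> /and3P[_ _ ->] /and3P[_ _ ->].
Qed.

Lemma cov_mE S x : (m x \in cov S) = (x \in cov S).
Proof. by apply/idP/idP => /cov_m //; rewrite mK. Qed.

(** An M*-edge dies only through [u] or [v], so the lost nodes lie in two partner pairs. The bounds
    4, 2 and 0 derived from this count endpoints of dying edges. *)
Lemma cov_step S u v :
  cov S \subset cov (u |: (v |: S)) :|: (cov S :&: [set u; m u])
                                  :|: (cov S :&: [set v; m v]).
Proof.
apply/subsetP => x xC; rewrite !in_setU !in_setI xC /= !in_set2.
have E y : (x == m y) = (m x == y) by rewrite -(inj_eq (inv_inj mK)) mK.
rewrite !E; move: xC; rewrite !inE !negb_or => /and3P[-> -> ->] /=.
by case: (x == u); case: (x == v); case: (m x == u); case: (m x == v).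
Qed.

Lemma card_covI2 S x : #|cov S :&: [set x; m x]| <= 2.
Proof.
apply: leq_trans (subset_leq_card (subsetIr _ _)) _.
by rewrite cards2; case: (_ != _).
Qed.

Lemma covI0 S x : x \notin cov S -> cov S :&: [set x; m x] = set0.
Proof.
move=> xC; apply/setP => y; rewrite in_setI in_set2 in_set0.
apply/negbTE/negP => /andP[yC /orP[] /eqP E]; move: yC; rewrite E ?cov_mE;
  exact/negP.
Qed.

Lemma card_cov4 S u v : #|cov S| <= #|cov (u |: (v |: S))| + 4.
Proof.
have := subset_leq_card (cov_step S u v); have := card_covI2 S u.
have := card_covI2 S v; rewrite !cardsU; nlia.
Qed.

Lemma card_cov2 S u v : m u = v \/ u \notin cov S \/ v \notin cov S ->
  #|cov S| <= #|cov (u |: (v |: S))| + 2.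
Proof.
have := subset_leq_card (cov_step S u v); have := card_covI2 S u.
have := card_covI2 S v => cv cu sub [muv|[/covI0 E|/covI0 E]].
- have E : [set v; m v] = [set u; m u] by rewrite -muv mK setUC.
  move: sub; rewrite E -setUA setUid !cardsU; nlia.
- move: sub; rewrite E setU0 !cardsU; nlia.
- move: sub; rewrite E setU0 !cardsU; nlia.
Qed.

Lemma card_cov0 S u v : u \notin cov S -> v \notin cov S ->
  #|cov S| <= #|cov (u |: (v |: S))|.
Proof.
move=> /covI0 Eu /covI0 Ev; have := subset_leq_card (cov_step S u v).
by rewrite Eu Ev !setU0.
Qed.

(** * Debt and neighbourhood counts *)

Lemma sum_mem B X : \sum_(w in B) (w \in X : nat) = #|B :&: X|.
Proof. by rewrite -sum1_card big_mkcond [RHS]big_mkcond /=; apply: eq_bigr => w _; rewrite inE; case: (w \in B); case: (w \in X). Qed.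

Lemma phi_le S S' B (l : T -> nat) :
  (forall w, w \in B -> minn 2 (cdeg e S w) <= minn 2 (cdeg e S' w) + l w) ->
  phi S B <= phi S' B + \sum_(w in B) l w.
Proof. by move=> H; rewrite /phi -big_split; apply: leq_sum. Qed.


Lemma cdeg_step0 S u v w : w = u \/ w = v -> cdeg e (u |: (v |: S)) w = 0.
Proof.
move=> H; apply/eqP; rewrite cards_eq0; apply/eqP/setP => y.
by rewrite !inE /cur !inE; case: H => ->; rewrite eqxx ?orbT ?andbF.
Qed.

Lemma nbE S w x : (w \in nb S x) = cur e S w x.
Proof. by rewrite inE cur_sym. Qed.

Lemma card_nbD1 S x y : cur e S x y -> #|nb S x :\ y| <= d.+3.
Proof.
move=> xy; have := cdeg_le S x; rewrite /cdeg -/(nb S x) (cardsD1 y) inE xy; nlia.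
Qed.

Lemma card_nbD2 S x y z : cur e S x y -> cur e S x z -> y != z ->
  #|nb S x :\ y :\ z| <= d.+2.
Proof.
move=> xy xz yz; have := card_nbD1 xy.
by rewrite (cardsD1 z) !inE xz eq_sym yz; nlia.
Qed.

Lemma nb1 S u v w : cur e S u v -> cdeg e S u = 1 -> cur e S u w -> w = v.
Proof.
move=> uv /eqP/cards1P[a E] uw.
have : w \in nb S u by rewrite inE.
have : v \in nb S u by rewrite inE.
by rewrite /nb E !inE => /eqP -> /eqP.
Qed.

Lemma nb2 S u v z w : cdeg e S u = 2 -> cur e S u v -> cur e S u z -> v != z ->
  cur e S u w -> w = v \/ w = z.
Proof.
move=> u2 uv uz vz uw.
have E : [set v; z] = nb S u.
  apply/eqP; rewrite eqEcard cards2 vz -[#|nb S u|]/(cdeg e S u) u2 leqnn andbT.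
  by apply/subsetP => y; rewrite !inE => /orP[] /eqP ->.
have : w \in [set v; z] by rewrite E inE.
by rewrite !inE => /orP[] /eqP; auto.
Qed.

Lemma disjoint_mem B X w : [disjoint B & X] -> w \in X -> w \notin B.
Proof. by rewrite disjoint_sym => H wX; rewrite (disjointFr H wX). Qed.

(** * Tokens and the invariant *)

(** Such a node needs no payment. If it is adjacent to [v], it takes a place that an indebted node
    could have; if not, it survives and the degree-1 nodes do not run out. *)
Definition idle S B := exists z, [/\ z \in ones S, z \notin B & z \notin cov S].

(* A token t is admissible only while degree-1 nodes exist.  The first bound is
   cleared by any single step; in the others the next step either clears the
   token or reduces it to a smaller bound.  The last one arises when a step
   killing two M*-edges turns D nodes, all free, into degree-1 nodes. *)
Definition token_ok S B t : Prop :=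
  ones S != set0 /\
  [\/ t <= d.+1, t <= #|ones S :&: B| <= d.+2, t <= d.+2 /\ idle S B
   | [/\ t <= d.+3, d.+4 <= #|ones S|, [disjoint ones S & cov S] & idle S B]].

Definition inv S B t : Prop :=
  [disjoint B & cov S] /\ (t = 0 \/ token_ok S B t).

(** Doubled, the charge D-1 per M*-edge is [d.+3] per live endpoint and the credit 2D-3 is
    [4 * d + 10]. [phi] and the token stand with the charges: they are surplus that later steps must
    still save. *)
Definition step_spec S B t S' : Prop := exists B' t',
  inv S' B' t' /\
  d.+3 * #|cov S| + phi S B + t
    <= 4 * d + 10 + d.+3 * #|cov S'| + phi S' B' + t'.

(** * Steps at a node of degree 1 *)

Lemma disjoint_step S B u v :
  [disjoint B & cov S] -> [disjoint B & cov (u |: (v |: S))].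
Proof. by apply: disjointWr; exact: cov_step_sub. Qed.

(** As [v] is the only neighbour of [u], at most one M*-edge dies. This leaves [2 * d + 4] for the
    old token and the indebted neighbours of [v]. *)
Lemma step_one S B t u v : cur e S u v -> cdeg e S u = 1 -> inv S B t ->
  step_spec S B t (u |: (v |: S)).
Proof.
move=> uv u1 [dB okt]; set S' := _ |: _.
have vu : cur e S v u by rewrite cur_sym.
have tD : t <= d.+3.
  case: okt => [->//|[_ [] H]]; [nlia|nlia|case: H; nlia|by case: H].
have loss w : w \in B ->
    minn 2 (cdeg e S w) <= minn 2 (cdeg e S' w) + ((w \in nb S v) + 2 * (w == v)).
  move=> wB; case: (eqVneq w v) => [->|wv]; first nlia.
  case: (eqVneq w u) => [->|wu]; first by rewrite u1 nbE uv; nlia.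
  rewrite (cdeg_step uv) // nbE.
  have -> : cur e S w u = false.
    apply/negbTE/negP; rewrite cur_sym => /(nb1 uv u1) E; by rewrite E eqxx in wv.
  rewrite -/S'; case: (cur e S w v); nlia.
have qnb : #|B :&: nb S v| <= d.+4.
  by apply: leq_trans (subset_leq_card (subsetIr _ _)) (cdeg_le S v).
have u_cov : u \in cov S -> m u = v.
  by move=> /cov_cur; exact: nb1.
(* If [v] is not covered, neither is [u], so no M*-edge dies; the full credit pays token, neighbours
   and [v] itself: at most (d+3) + (d+4) + 2. *)
case: (boolP (v \in cov S)) => vC; last first.
  exists B, 0; split; first by split; [exact: disjoint_step|left].
  have uC : u \notin cov S by apply: contra vC => uC; rewrite -(u_cov uC) cov_mE.
  have := phi_le loss; rewrite big_split sum_mem -big_distrr /=.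
  have : \sum_(w in B) (w == v) <= 1.
    by rewrite (eq_bigr (fun w => w \in [set v] : nat)) ?sum_mem => [|w _];
      rewrite ?in_set1 // (leq_trans (subset_leq_card (subsetIr _ _))) ?cards1.
  have := leq_mul (leqnn d.+3) (card_cov0 uC vC); rewrite -/S'; nlia.
have vB := disjoint_mem dB vC.
have mvB : m v \notin B by apply: disjoint_mem dB _; rewrite cov_mE.
have mvn : cur e S v (m v) := cov_cur vC.
have pay : phi S B <= phi S' B + #|B :&: nb S v|.
  rewrite -sum_mem; apply: phi_le => w wB; have := loss w wB.
  by rewrite (_ : w == v = false) ?addn0 //; apply: contraNF vB => /eqP <-.
have q1 : #|B :&: nb S v| <= d.+3.
  apply: leq_trans (card_nbD1 mvn); apply: subset_leq_card.
  apply/subsetP => w; rewrite in_setI in_setD1 => /andP[wB ->]; rewrite andbT.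
  by apply: contraNneq mvB => <-.
have cC : #|cov S| <= #|cov S'| + 2.
  apply: card_cov2; case: (boolP (u \in cov S)) => [/u_cov|]; auto.
have cC' := leq_mul (leqnn d.+3) cC; rewrite mulnDr in cC'.
have q2 z : z \notin B -> z \notin cov S -> cur e S v z ->
    #|B :&: nb S v| <= d.+2.
  move=> zB zC vz.
  have zm : m v != z by apply: contraNneq zC => <-; rewrite cov_mE.
  apply: leq_trans (card_nbD2 mvn vz zm); apply: subset_leq_card.
  apply/subsetP => w; rewrite in_setI !in_setD1 => /andP[wB ->]; rewrite andbT.
  by apply/andP; split; apply: contraTneq wB => ->.
have surv w : w \in ones S -> w != v -> ~~ cur e S v w -> w \in ones S'.
  rewrite !inE cur_sym => w1 wv Nwv.
  have wu : w != u by apply: contraNneq Nwv => ->.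
  have Nwu : ~~ cur e S w u.
    by rewrite cur_sym; apply: contraNN wv => /(nb1 uv u1) ->.
  by rewrite (cdeg_step uv) // (negPf Nwu) (negPf Nwv) !addn0 in w1.
have nv z : z \notin cov S -> z != v by apply: contraNneq => ->.
have idle_step z : z \in ones S -> z \notin B -> z \notin cov S ->
    #|B :&: nb S v| <= d.+2 \/ idle S' B.
  move=> zA zB zC; case: (boolP (cur e S v z)) => [/(q2 z zB zC)|vz]; auto.
  right; exists z; split=> //; first by apply: surv => //; exact: nv.
  by apply: contra zC => /(subsetP (cov_step_sub _ _ _)).
(* While degree-1 nodes remain, whatever exceeds [2 * d + 4] becomes the new token; the subtraction
   truncates at 0. *)
case: (eqVneq (ones S') set0) => [A0|A0]; last first.
  exists B, (t + #|B :&: nb S v| - (2 * d + 4)); split; last nlia.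
  split; first exact: disjoint_step.
  right; split=> //; case: okt => [->|[_ [] H]].
  - by constructor 1; nlia.
  - by constructor 1; nlia.
  - by constructor 1; nlia.
  - by constructor 1; nlia.
  (* Here 2 may be left over, too much for the first bound when d = 0; the idle node lowers the cost
     by one or stays idle. *)
  - case: H => tD1 _ _ [z [zA zB zC]].
    case: (idle_step z zA zB zC) => [q3|idl]; first by constructor 1; nlia.
    by constructor 3; split=> //; nlia.
exists B, 0; split; first by split; [exact: disjoint_step|left].
have noidle : ~ idle S' B by case=> z []; rewrite A0 inE.
suff : phi S B + t <= phi S' B + (2 * d + 4) by nlia.
case: okt => [->|[_ [] H]]; try nlia.
(* No degree can fall from 2 to 1 now, so only indebted nodes already of degree 1 lose. *)
- suff : phi S B <= phi S' B + #|B :&: ones S| by rewrite setIC in H; nlia.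
  rewrite -sum_mem; apply: phi_le => w wB; have := loss w wB.
  have -> : (w == v) = false by apply: contraNF vB => /eqP <-.
  have : w \notin ones S' by rewrite A0 inE.
  rewrite !inE; case: (eqVneq w u) => [->|wu]; first by rewrite u1; nlia.
  rewrite (cdeg_step uv) //; last by apply: contraNneq vB => <-.
  rewrite cur_sym (cur_sym S w v) -/S'.
  have -> : cur e S u w = false.
    by apply: contraNF vB => /(nb1 uv u1) <-.
  by case: (cur e S v w); nlia.
- case: H => tD2 [z [zA zB zC]].
  by case: (idle_step z zA zB zC) => [|//]; nlia.
(* All these D free nodes would be neighbours of [v], but [m v] is a further neighbour. *)
- case: H => _ DA dA _; exfalso.
  suff : #|ones S| <= d.+3 by nlia.
  apply: leq_trans (card_nbD1 mvn); apply: subset_leq_card.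
  apply/subsetP => w wA; have wC : w \notin cov S by rewrite (disjointFr dA wA).
  rewrite !inE; apply/andP; split.
    by apply: contraNneq wC => ->; rewrite cov_mE.
  apply: contraT => Nvw; have := surv w wA (nv w wC) Nvw.
  by rewrite A0 inE.
Qed.

(* The situation of a step taken when no node has degree 1. *)
Definition tight_start S u : Prop :=
  (forall x, 0 < cdeg e S x -> 3 <= cdeg e S x) \/
  (cdeg e S u = 2 /\ forall x, 0 < cdeg e S x -> 2 <= cdeg e S x).

(** * Steps killing two M*-edges *)

(** The charge [4 * d + 12] exceeds the credit by 2, which a new indebted node [m u] or [m v] takes
    over. *)
Lemma step_bad S B u v : cur e S u v -> tight_start S u ->
  [disjoint B & cov S] -> u \in cov S -> v \in cov S -> m u != v ->
  step_spec S B 0 (u |: (v |: S)).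
Proof.
move=> uv tight dB uC vC muv; set S' := _ |: _.
have vu : cur e S v u by rewrite cur_sym.
have CB x : x \in cov S -> x \notin B by exact: disjoint_mem.
have mvu : m v != u by apply: contraNneq muv => <-; rewrite mK.
have umu := cov_cur uC; have vmv := cov_cur vC.
have m12 : m u != m v by rewrite (inj_eq (inv_inj mK)) (cur_neq uv).
have mu_u : m u != u by rewrite eq_sym (cur_neq umu).
have mv_v : m v != v by rewrite eq_sym (cur_neq vmv).
have zC' z : z = m u \/ z = m v -> z \notin cov S'.
  by case=> ->; rewrite !inE !negb_or !mK !eqxx ?andbF //=; rewrite ?andbF.
have min2 x : 0 < cdeg e S x -> 2 <= cdeg e S x.
  by case: tight => [H /H|[_ H /H]]; nlia.
have posmu : 2 <= cdeg e S (m u) by apply: min2; apply: (@cur_cdeg _ _ u); rewrite cur_sym.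
have posmv : 2 <= cdeg e S (m v) by apply: min2; apply: (@cur_cdeg _ _ v); rewrite cur_sym.
have dmu : cdeg e S (m u) = cdeg e S' (m u) + 1 + cur e S (m u) v.
  by rewrite (cdeg_step uv) // (cur_sym S (m u) u) umu.
have dmv : cdeg e S (m v) = cdeg e S' (m v) + cur e S (m v) u + 1.
  by rewrite (cdeg_step uv) // (cur_sym S (m v) v) vmv.
(* A node [z] of degree at least 2 carries the deficit 2 in [phi]; at degree 1 it carries 1 and the
   token 1. The token also repays 1 for each old indebted node now of degree 1. *)
have finish z : z = m u \/ z = m v -> 0 < cdeg e S' z ->
    (#|ones S' :&: (z |: B)| <= d.+2 \/ token_ok S' (z |: B) (#|ones S' :&: (z |: B)|)) ->
    (forall w, w \in B -> minn 2 (cdeg e S w) <= minn 2 (cdeg e S' w) + (w \in ones S')) ->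
    step_spec S B 0 S'.
  move=> zE z_pos tok loss; exists (z |: B), #|ones S' :&: (z |: B)|.
  have zB : z \notin B by case: zE => ->; apply: CB; rewrite cov_mE.
  split; first split.
  - rewrite disjoints_subset; apply/subsetP => w; rewrite in_setU1 in_setC.
    case/predU1P => [->|wB]; first exact: zC'.
    by rewrite (disjointFr (disjoint_step u v dB) wB).
  - case: (posnP #|ones S' :&: (z |: B)|) => [->|A0]; first by left.
    right; case: tok => // tD; split; last by constructor 2; rewrite leqnn.
    by case/card_gt0P: A0 => x; rewrite in_setI => /andP[xA _]; apply/set0Pn; exists x.
  - have := phi_le loss; rewrite sum_mem => L.
    have cC := leq_mul (leqnn d.+3) (card_cov4 S u v).
    rewrite mulnDr -/S' in cC.
    have E1 : phi S' (z |: B) = minn 2 (cdeg e S' z) + phi S' B by rewrite /phi big_setU1.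
    have E2 : #|ones S' :&: (z |: B)| = (z \in ones S') + #|B :&: ones S'|.
      by rewrite setIC -!sum_mem big_setU1.
    rewrite E1 E2 inE; case: eqP => /=; nlia.
have Buv w : w \in B -> w != u /\ w != v.
  by move=> wB; split; apply: contraTneq wB => ->; apply: CB.
have Auv w : w \in ones S' -> w != u /\ w != v.
  by rewrite inE => /eqP w1; split; apply/eqP => E; move: w1;
    rewrite cdeg_step0; auto.
have sub_nbv X : (forall w, w \in X -> cur e S v w) -> u \notin X ->
    m v \notin X -> X \subset nb S v :\ u :\ m v.
  move=> XN uX mvX; apply/subsetP => w wX; rewrite !inE (XN w wX) andbT.
  by apply/andP; split; apply: contraTneq wX => ->.
have card_nbv : #|nb S v :\ u :\ m v| <= d.+2.
  by apply: card_nbD2; rewrite // eq_sym.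
case: tight => [min3|[u2 _]].
  have mu3 : 3 <= cdeg e S (m u) by apply: min3; nlia.
  apply: (finish (m u)); first by left.
  - by case: (cur e S (m u) v) dmu; nlia.
  (* A fall from degree at least 3 to 1 requires adjacency to both [u] and [v]. *)
  - left; apply: leq_trans card_nbv; apply: subset_leq_card; apply: sub_nbv.
    + move=> w; rewrite in_setI => /andP[wA _]; have [wu wv] := Auv w wA.
      move: wA; rewrite inE => /eqP w1; have := cdeg_step uv wu wv.
      rewrite -/S' w1 (cur_sym S v w) => E; have := min3 w.
      by case: (cur e S w v) E => //; case: (cur e S w u); nlia.
    + by apply/negP; rewrite in_setI => /andP[/Auv[]]; rewrite eqxx.
    + by rewrite in_setI in_setU1 (eq_sym (m v)) (negPf m12) (negPf (CB (m v) _)) ?cov_mE ?andbF.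
  - move=> w wB; have [wu wv] := Buv w wB; have := cdeg_step uv wu wv.
    rewrite -/S' inE => E; have := min3 w.
    by move: E; case: (cur e S w u); case: (cur e S w v); case: eqP; nlia.
have nbu w : cur e S u w -> w = v \/ w = m u.
  by move=> uw; apply: (nb2 u2 uv umu) uw; rewrite eq_sym.
(* Both neighbours of [u] are covered, hence not indebted; so an indebted node loses only its edge
   to [v]. *)
have Bu w : w \in B -> cur e S w u = false.
  move=> wB; apply/negP; rewrite cur_sym => /nbu[] E; move: wB; apply/negP.
    by rewrite E CB.
  by rewrite E CB // cov_mE.
have loss w : w \in B ->
    minn 2 (cdeg e S w) <= minn 2 (cdeg e S' w) + (w \in ones S').
  move=> wB; have [wu wv] := Buv w wB; have := cdeg_step uv wu wv.
  rewrite -/S' inE (Bu w wB) => E; have := min2 w.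
  by move: E; case: (cur e S w v); case: eqP; nlia.
have mvu0 : cur e S (m v) u = false.
  apply/negP; rewrite cur_sym => /nbu[] E; first by rewrite E eqxx in mv_v.
  by rewrite E eqxx in m12.
rewrite mvu0 in dmv.
have BA_nbv : ones S' :&: B \subset nb S v :\ u :\ m v.
  apply: sub_nbv.
  - move=> w; rewrite in_setI => /andP[wA wB]; have [wu wv] := Buv w wB.
    move: wA; rewrite inE => /eqP w1; have := cdeg_step uv wu wv.
    rewrite -/S' w1 (cur_sym S v w) (Bu w wB) => E; have := min2 w.
    by case: (cur e S w v) E => //; nlia.
  - by rewrite in_setI (negPf (CB u uC)) andbF.
  - by rewrite in_setI (negPf (CB (m v) _)) ?cov_mE ?andbF.
have cBA := leq_trans (subset_leq_card BA_nbv) card_nbv.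
have cardU z : #|ones S' :&: (z |: B)| <= (z \in ones S') + #|ones S' :&: B|.
  case: (boolP (z \in ones S')) => zA.
    apply: (@leq_trans #|z |: (ones S' :&: B)|).
      apply: subset_leq_card; apply/subsetP => w; rewrite !inE.
      by case: (w == z) => //=.
    by rewrite cardsU1; case: (z \notin _).
  apply: subset_leq_card; apply/subsetP => w; rewrite !in_setI in_setU1.
  by case: eqP => [->|//]; rewrite (negPf zA).
case: (leqP 2 (cdeg e S' (m u))) => mu2.
  apply: (finish (m u)) => //; [by left|by nlia|left].
  apply: leq_trans (cardU _) _; rewrite inE; case: eqP => /=; nlia.
case: (leqP 2 (cdeg e S' (m v))) => mv2.
  apply: (finish (m v)) => //; [by right|by nlia|left].
  apply: leq_trans (cardU _) _; rewrite inE; case: eqP => /=; nlia.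
have mv1 : cdeg e S' (m v) = 1 by move: dmv; nlia.
have mvA : m v \in ones S' by rewrite inE mv1.
case: (boolP (cur e S (m u) v)) => muv_adj.
  apply: (finish (m v)) => //; [by right|by nlia|left].
  apply: leq_trans (cardU _) _; rewrite mvA add1n ltnS.
  (* The non-indebted [m u] occupies a place among the neighbours of [v], which makes room for [m v]
     in the count. *)
  suff : #|ones S' :&: B| < #|nb S v :\ u :\ m v| by nlia.
  apply: proper_card; rewrite properE BA_nbv; apply/subsetPn; exists (m u).
    by rewrite !inE m12 mu_u cur_sym muv_adj.
  by rewrite in_setI (negPf (CB (m u) _)) ?cov_mE ?andbF.
have mu1 : cdeg e S' (m u) = 1 by move: dmu muv_adj; case: cur => //; nlia.
have muA : m u \in ones S' by rewrite inE mu1.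
apply: (finish (m u)) => //; [by left|by nlia|].
have := cardU (m u); rewrite muA => tD.
case: (leqP #|ones S' :&: (m u |: B)| d.+2) => tD2; [by left|right].
(* Extremal case: indebted nodes fill all remaining places at [v]. Together with [m u] and [m v]
   they are all the degree-1 nodes, and [m v] is idle. *)
have EB : ones S' :&: B = nb S v :\ u :\ m v.
  apply/eqP; rewrite eqEcard BA_nbv; nlia.
split; first by apply/set0Pn; exists (m u).
constructor 4; split.
- by nlia.
- apply: (@leq_trans #|m u |: (m v |: (ones S' :&: B))|).
    rewrite !cardsU1 !in_setU1 !in_setI (negPf m12).
    by rewrite !(negPf (CB _ _)) ?cov_mE // !andbF /=; nlia.
  apply: subset_leq_card; apply/subsetP => w; rewrite !in_setU1 in_setI.
  by case/or3P => [/eqP->|/eqP->|/andP[]].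
- rewrite disjoints_subset; apply/subsetP => w wA; rewrite in_setC.
  have [wu wv] := Auv w wA.
  case: (eqVneq w (m u)) => [->|wmu]; first by apply: zC'; left.
  case: (eqVneq w (m v)) => [->|wmv]; first by apply: zC'; right.
  have Nuw : cur e S w u = false.
    by apply/negP; rewrite cur_sym => /nbu[] E; rewrite E eqxx in wmu wv.
  suff : w \in ones S' :&: B.
    rewrite in_setI => /andP[_ wB].
    by apply: contraTN wB => wC; apply: CB; apply: (subsetP (cov_step_sub _ _ _)) wC.
  rewrite EB !inE wu wmv /= cur_sym; have := cdeg_step uv wu wv.
  move: wA; rewrite -/S' inE Nuw => /eqP -> E; have := min2 w.
  by case: (cur e S w v) E => //; nlia.
- exists (m v); split=> //; last by apply: zC'; right.
  by rewrite in_setU1 eq_sym (negPf m12) CB // cov_mE.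
Qed.

(** * Other steps without degree-1 nodes *)

(** At most one M*-edge dies. Each of the [p] indebted endpoints costs at most 2, the other nodes
    [q] in total. With exactly one covered endpoint the cost is at most d+5, which exceeds
    [2 * d + 4] only for d = 0, by 1; hence the token 1. *)
Lemma step_start S B u v : cur e S u v -> tight_start S u ->
  [disjoint B & cov S] -> m u = v \/ u \notin cov S \/ v \notin cov S ->
  step_spec S B 0 (u |: (v |: S)).
Proof.
move=> uv tight dB cases; set S' := _ |: _.
have vu : cur e S v u by rewrite cur_sym.
have CB x : x \in cov S -> x \notin B by exact: disjoint_mem.
have dB' : [disjoint B & cov S'] by exact: disjoint_step.
pose p := #|B :&: [set u; v]|.
have pE : \sum_(w in B) 2 * (w \in [set u; v]) = 2 * p.
  by rewrite -big_distrr /= sum_mem.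
have lossU w : w = u \/ w = v ->
    minn 2 (cdeg e S w) <= minn 2 (cdeg e S' w) + 2 * (w \in [set u; v]).
  by case=> ->; rewrite !inE eqxx ?orbT; nlia.
have cardU := card_nbD1 uv; have cardV := card_nbD1 vu.
have capI X k : #|X| <= k -> #|B :&: X| <= k.
  by apply: leq_trans; exact: subset_leq_card (subsetIr _ _).
have capD X x k : x \in cov S -> x \in X -> #|X| <= k.+1 -> #|B :&: X| <= k.
  move=> xC xX Xk; rewrite -ltnS; apply: leq_trans Xk; apply: proper_card.
  rewrite properE subsetIr; apply/subsetPn; exists x => //.
  by rewrite in_setI (negPf (CB x xC)).
have [q [q1 q2 q3]] : exists q, [/\ phi S B <= phi S' B + 2 * p + q,
    q <= d.+4 & m u <> v -> (u \in cov S) || (v \in cov S) -> q <= d.+3].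
  case: tight => [min3|[u2 min2]].
    (* From degree at least 3 only common neighbours of [u] and [v] lose, so counting at [u]
       suffices. *)
    exists #|B :&: (nb S u :\ v)|; split=> [||_ _].
    - rewrite -addnA -pE -sum_mem -big_split; apply: phi_le => w wB /=.
      case: (eqVneq w u) => [->|wu]; first by have := lossU u (or_introl erefl); nlia.
      case: (eqVneq w v) => [->|wv]; first by have := lossU v (or_intror erefl); nlia.
      have := cdeg_step uv wu wv; have := min3 w; rewrite -/S'.
      rewrite !inE (negPf wu) (negPf wv) /= (cur_sym S u w).
      by case: (cur e S w u); case: (cur e S w v); nlia.
    - by apply: capI; nlia.
    - by apply: capI; nlia.
  exists (#|B :&: (nb S u :\ v)| + #|B :&: (nb S v :\ u)|).
  have u1 : #|nb S u :\ v| <= 1.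
    by move: u2; rewrite /cdeg -/(nb S u) (cardsD1 v) inE uv; nlia.
  split.
  - rewrite -addnA -pE -!sum_mem -[X in _ + (_ + X)]big_split.
    rewrite -[X in _ + X]big_split; apply: phi_le => w wB /=.
    case: (eqVneq w u) => [->|wu]; first by have := lossU u (or_introl erefl); nlia.
    case: (eqVneq w v) => [->|wv]; first by have := lossU v (or_intror erefl); nlia.
    have := cdeg_step uv wu wv; rewrite -/S'.
    rewrite !inE (negPf wu) (negPf wv) /= (cur_sym S u w) (cur_sym S v w).
    by case: (cur e S w u); case: (cur e S w v); nlia.
  - have := capI _ _ u1; have := capI _ _ cardV; nlia.
  - move=> muv /orP[uC|vC].
      have : #|B :&: (nb S u :\ v)| <= 0.
        apply: (capD _ (m u)); rewrite ?cov_mE // in_setD1 nbE cur_sym cov_cur //.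
        by rewrite andbT; apply/eqP.
      by have := capI _ _ cardV; nlia.
    have : #|B :&: (nb S v :\ u)| <= d.+2.
      apply: (capD _ (m v)); rewrite ?cov_mE // in_setD1 nbE cur_sym cov_cur //.
      by rewrite andbT; apply/eqP => E; apply: muv; rewrite -E mK.
    by have := capI _ _ u1; nlia.
(* Without new degree-1 nodes no token is allowed, but then only a fall from 2 to 0 costs anything,
   and [u] of degree 2 has just one neighbour besides [v]. *)
have q0 : ones S' = set0 -> phi S B <= phi S' B + 2 * p + 2.
  move=> A0.
  have A0w w : cdeg e S' w != 1.
    by have := in_set0 w; rewrite -A0 inE => ->.
  case: tight => [min3|[u2 min2]].
    suff : phi S B <= phi S' B + 2 * p by nlia.
    rewrite -pE; apply: phi_le => w wB.
    case: (eqVneq w u) => [->|wu]; first by apply: lossU; left.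
    case: (eqVneq w v) => [->|wv]; first by apply: lossU; right.
    have := cdeg_step uv wu wv; have := min3 w; have /eqP := A0w w; rewrite -/S'.
    by case: (cur e S w u); case: (cur e S w v); nlia.
  have u1 : #|nb S u :\ v| <= 1.
    by move: u2; rewrite /cdeg -/(nb S u) (cardsD1 v) inE uv; nlia.
  suff : phi S B <= phi S' B + (2 * p + 2 * #|B :&: (nb S u :\ v)|).
    by have := capI _ _ u1; nlia.
  rewrite -pE -sum_mem big_distrr -big_split; apply: phi_le => w wB /=.
  case: (eqVneq w u) => [->|wu]; first by have := lossU u (or_introl erefl); nlia.
  case: (eqVneq w v) => [->|wv]; first by have := lossU v (or_intror erefl); nlia.
  have := cdeg_step uv wu wv; have := min2 w; have /eqP := A0w w; rewrite -/S'.
  rewrite !inE (negPf wu) (negPf wv) /= (cur_sym S u w).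
  by case: (cur e S w u); case: (cur e S w v); nlia.
have pUV : p <= (u \notin cov S) + (v \notin cov S).
  rewrite /p setIC -sum_mem big_setU1 ?in_set1 ?(cur_neq uv) //= big_set1.
  have nC x : (x \in B) <= (x \notin cov S).
    by case: (boolP (x \in cov S)) => [/CB/negPf->//|_]; exact: leq_b1.
  exact: leq_add.
have spec t k : t <= 1 -> (t = 1 -> ones S' != set0) ->
    #|cov S| <= #|cov S'| + k -> phi S B + d.+3 * k <= 4 * d + 10 + phi S' B + t ->
    step_spec S B 0 S'.
  move=> t1 tA cC H; exists B, t; split.
    split=> //; case: t t1 tA {H} => [|[|//]] _ tA; [by left|right].
    by split; [exact: tA|constructor 1].
  by have := leq_mul (leqnn d.+3) cC; rewrite mulnDr; nlia.
have cC := card_cov2 cases.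
case: (boolP (u \in cov S)) pUV q3 => uC; last first.
  case: (boolP (v \in cov S)) => vC /= pUV q3; last first.
    by apply: (spec 0 0); rewrite ?addn0 ?card_cov0 //; nlia.
  have muv : m u <> v by move=> E; move: vC; rewrite -E cov_mE (negPf uC).
  have := q3 muv isT.
  case: (eqVneq (ones S') set0) => A0 q3'.
    by apply: (spec 0 2) => //; have := q0 A0; nlia.
  by apply: (spec 1 2) => //; nlia.
case: (boolP (v \in cov S)) => vC /= pUV q3.
  by apply: (spec 0 2) => //; nlia.
have muv : m u <> v by move=> E; move: vC; rewrite -E cov_mE uC.
have := q3 muv isT.
case: (eqVneq (ones S') set0) => A0 q3'.
  by apply: (spec 0 2) => //; have := q0 A0; nlia.
by apply: (spec 1 2) => //; nlia.
Qed.

(** * Summation over the run *)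

Lemma run_bound s S B t : mingreedy_run e S s -> inv S B t ->
  d.+3 * #|cov S| + phi S B + t <= (4 * d + 10) * size s.
Proof.
elim: s S B t => [|[u v] s IH] S B t /=.
  move=> stop [dB okt].
  have deg0 x : cdeg e S x = 0.
    by apply/eqP; rewrite cards_eq0; apply/eqP/setP => y; rewrite !inE (negPf (stop x y)).
  have -> : cov S = set0.
    by apply/setP => x; rewrite in_set0; apply: contraTF (stop x (m x)) => /cov_cur ->.
  rewrite cards0 /phi big1 => [|w _]; last by rewrite deg0.
  case: okt => [->|[/set0Pn[x]]]; first by nlia.
  by rewrite inE deg0.
case=> uv choice run iS.
suff [B' [t' [iS' le]]] : step_spec S B t (u |: (v |: S)).
  by have := IH _ _ _ run iS'; rewrite mulnS; nlia.
have u_pos := cur_cdeg uv.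
case: (eqVneq (ones S) set0) => [A0|/set0Pn[x]]; last first.
  rewrite inE => /eqP x1; apply: step_one => //.
  (* A degree-1 node rules out the arbitrary choice and forces [u] to have degree 1. *)
  by case: choice => /(_ x); rewrite x1; [move=> /(_ isT)|move=> /(_ isT); nlia].
have N1 x : cdeg e S x <> 1.
  by move=> x1; have : x \in ones S; [rewrite inE x1|rewrite A0 inE].
case: iS => dB [->|[]]; last by rewrite A0 eqxx.
have tight : tight_start S u.
  case: choice => [|mind]; first by left.
  case: (leqP 3 (cdeg e S u)) => u3; [left|right].
    by move=> x /mind; exact: leq_trans.
  by split=> [|x x0]; [have := N1 u|have := N1 x]; nlia.
case: (boolP (u \in cov S)) => uC; last by apply: step_start => //; auto.
case: (boolP (v \in cov S)) => vC; last by apply: step_start => //; auto.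
case: (eqVneq (m u) v) => muv; last exact: step_bad.
by apply: step_start => //; auto.
Qed.

End Potential.

Theorem theorem2 (D : nat) (T : finType) (e : rel T) (Mstar : {set {set T}})
    (s : seq (T * T)) :
  4 <= D ->
  simple_graph e ->
  max_deg_le e D ->
  is_maximum_matching e Mstar ->
  mingreedy_run e set0 s ->
  (D - 1) * #|Mstar| <= (2 * D - 3) * #|run_matching s|.
Proof.
case: D => [|[|[|[|d]]]] // _ [e_sym e_irr] e_deg [M_matching _] run.
have inv0 : inv d e (partner Mstar) set0 set0 0 by split; [rewrite disjoints_subset sub0set|left].
have := run_bound e_sym e_irr e_deg (partnerK M_matching)
  (partner_edge e_sym M_matching) run inv0.
have -> : cov (partner Mstar) set0 = [set x | partner Mstar x != x].
  by apply/setP => x; rewrite !inE !andbT.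
rewrite (card_partner e_irr M_matching) /phi big_set0 !addn0 => bound.
have := leq_mul (leqnn (2 * d + 5)) (size_run_matching run).
rewrite subn1 (_ : 2 * d.+4 - 3 = 2 * d + 5); last by clear; lia.
(* The factor 2 from counting endpoints cancels the doubled credit. *)
move=> size_le; rewrite -(leq_pmul2l (isT : 0 < 2)) mulnCA (leq_trans bound) //.
rewrite (_ : 4 * d + 10 = 2 * (2 * d + 5)); last by clear; lia.
by rewrite -mulnA leq_pmul2l.
Qed.
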